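(* Let $d\ge2$, let $E_\mu=\mathbb{R}^{n_\mu}$ and let $M_\mu\in\mathbb{R}^{n_\mu\times n_\mu}$ be symmetric positive definite for $\mu\in\{1,\dots,d\}$. Let $\mathcal{S}_M$ be $E_1\otimes\dots\otimes E_d$ endowed with the inner product induced by $M_1,\dots,M_d$, let $\mathcal{S}$ be the same space with the standard inner product, and let $\nu:\mathcal{S}_M\to\mathcal{S}$, $\nu(\mathbf{A})=(M_1,\dots,M_d)\mathbf{A}$. Let $\mathbf{F}\in\mathcal{S}_M$ and let $\mathbf{X}=\nu(\mathbf{F})$ be its image in $\mathcal{S}$. Let $(U_\mu)_\mu$, $U_\mu\in\mathbb{R}^{n_\mu\times r_\mu}$, be the HOSVD basis and $\mathbf{C}$ the HOSVD core tensor of $\mathbf{X}$ at multilinear rank $\mathbf{r}=(r_1,\dots,r_d)$, with $r_\mu\le\operatorname{rank}(X^{(\mu)})$ for all $\mu\in\{1,\dots,d\}$, so that $\mathbf{X}$ is expressed as $\mathbf{X}=(U_1,\dots,U_d)\mathbf{C}$. Let $\Sigma_\mu$ be the diagonal matrix of singular values of $X^{(\mu)}$ associated with the columns of $U_\mu$, let $Y_\mu=U_\mu\Sigma_\mu$, and let $W_\mu=M_\mu^{-1}Y_\mu$ be the principal components of mode $\mu$ of $\mathbf{F}$ in $\mathcal{S}_M$. Then for every $\mu\in\{1,\dots,d\}$ $$W_\mu=F^{(\mu)}\,(M_d^2W_d\otimes_K\dots\otimes_K M_{\mu+1}^2W_{\mu+1}\otimes_K M_{\mu-1}^2W_{\mu-1}\otimes_K\dots\otimes_K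 M_1^2W_1)\,(B^{(\mu)})^{T},$$ where $\mathbf{B}=(\Sigma_1^{-1},\dots,\Sigma_d^{-1})\mathbf{C}$.
   Context: For a tensor $\mathbf{A}\in\mathbb{R}^{n_1\times\dots\times n_d}$, the matricization $A^{(\mu)}$ with respect to mode $\mu$ is the matrix with $n_\mu$ rows and $\prod_{\alpha\neq\mu}n_\alpha$ columns whose entry in row $i_\mu$ and column $\overline{i_1,\dots,i_{\mu-1},i_{\mu+1},\dots,i_d}=1+\sum_{\alpha\ne\mu}(i_\alpha-1)m_\alpha$, with $m_\alpha=\prod_{\beta<\alpha,\ \beta\neq\mu}n_\beta$, is $A_{i_1\dots i_d}$. $\otimes_K$ is the Kronecker product of matrices. For matrices $M_\mu$ of compatible size, $(M_1,\dots,M_d)\mathbf{A}$ is the tensor-times-matrix product: $(M_1,\dots,M_d)(\mathbf{a}_1\otimes\dots\otimes\mathbf{a}_d)=M_1\mathbf{a}_1\otimes\dots\otimes M_d\mathbf{a}_d$, extended linearly. The inner product on $E_\mu$ induced by $M_\mu$ is $\langle\mathbf{a},\mathbf{a}'\rangle_{M_\mu}=\langle M_\mu\mathbf{a},M_\mu\mathbf{a}'\rangle$, and on the tensor space it is $\langle\mathbf{A},\mathbf{A}'\rangle=\langle(M_1,\dots,M_d)\mathbf{A},(M_1,\dots,M_d)\mathbf{A}'\rangle$, so $\nu$ is an isometry. HOSVD of $\mathbf{X}$ at multilinear rank $\mathbf{r}$: for each mode $\mu$, the matrix $U_\mu\in\mathbb{R}^{n_\mu\times r_\mu}$ has as its columns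 orthonormal left singular vectors of $X^{(\mu)}$ associated with its $r_\mu$ largest singular values $\sigma^{(\mu)}_1\ge\dots\ge\sigma^{(\mu)}_{r_\mu}$; $\Sigma_\mu=\operatorname{diag}(\sigma^{(\mu)}_1,\dots,\sigma^{(\mu)}_{r_\mu})$; and the core is $\mathbf{C}=(U_1^{T},\dots,U_d^{T})\mathbf{X}$. *)

(* Defs.v *)
From mathcomp Require Import all_boot all_order all_algebra.
From mathcomp Require Import mxtens reals.

Set Implicit Arguments.
Unset Strict Implicit.
Unset Printing Implicit Defensive.

Import Order.TTheory GRing.Theory Num.Theory.
Local Open Scope ring_scope.

(* Modes and indices are numbered from 0: mode mu ranges over 'I_d and the    *)
(* index in mode mu over 'I_(n mu).                                           *)
Notation multi_index n := {dffun forall mu, 'I_(n mu)}.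
Notation tensor R n := {ffun multi_index n -> R}.

Definition elementary (R : realType) (d : nat) (n : 'I_d -> nat)
    (a : forall mu, 'cV[R]_(n mu)) : tensor R n :=
  [ffun i : multi_index n => \prod_mu a mu (i mu) 0].

(* (M_1, .., M_d) A, in coordinates; see ttm_elementary and ttm_linear.       *)
Definition ttm (R : realType) (d : nat) (n p : 'I_d -> nat)
    (M : forall mu, 'M[R]_(p mu, n mu)) (A : tensor R n) : tensor R p :=
  [ffun i : multi_index p => \sum_(j : multi_index n) (\prod_mu M mu (i mu) (j mu)) * A j].

Lemma prod_sum_multi_index (R : realType) (d : nat) (n : 'I_d -> nat)
    (F : forall mu, 'I_(n mu) -> R) :
  \prod_mu \sum_(k < n mu) F mu k =
    \sum_(j : multi_index n) \prod_mu F mu (j mu).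
Proof.
rewrite (reindex (@dffun_of_fprod _ (fun mu => 'I_(n mu)))); last first.
  exact/onW_bij/dffun_of_fprod_bij.
pose G mu : {ffun 'I_(n mu) -> R} := finfun (F mu).
transitivity (\prod_mu \sum_(k : 'I_(n mu)) G mu k).
  by apply: eq_bigr => mu _; apply: eq_bigr => k _; rewrite ffunE.
under eq_bigr do rewrite (big_tag (fun mu => G mu)).
rewrite bigA_distr_big_dep -(big_fprod _ _ G).
apply: eq_bigr => t _; apply: eq_bigr => mu _.
by rewrite !ffunE.
Qed.

Lemma ttm_elementary (R : realType) (d : nat) (n p : 'I_d -> nat)
    (M : forall mu, 'M[R]_(p mu, n mu)) (a : forall mu, 'cV[R]_(n mu)) :
  ttm M (elementary a) = elementary (fun mu => M mu *m a mu).
Proof.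
apply/ffunP => i; rewrite !ffunE.
under [RHS]eq_bigr do rewrite mxE.
rewrite prod_sum_multi_index; apply: eq_bigr => j _.
by rewrite ffunE -big_split.
Qed.

Lemma ttm_linear (R : realType) (d : nat) (n p : 'I_d -> nat)
    (M : forall mu, 'M[R]_(p mu, n mu)) (c : R) (A B : tensor R n) :
  ttm M [ffun i => c * A i + B i] = [ffun i => c * ttm M A i + ttm M B i].
Proof.
apply/ffunP => i; rewrite !ffunE mulr_sumr -big_split.
by apply: eq_bigr => j _; rewrite ffunE mulrDr mulrCA.
Qed.

Definition tdot (R : realType) (d : nat) (n : 'I_d -> nat)
    (A B : tensor R n) : R := \sum_i A i * B i.

Definition tdotM (R : realType) (d : nat) (n : 'I_d -> nat)
    (M : forall mu, 'M[R]_(n mu)) (A B : tensor R n) : R :=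
  tdot (ttm M A) (ttm M B).

(* The isometry from the space with inner product tdotM M to the one with     *)
(* inner product tdot.                                                        *)
Definition nu (R : realType) (d : nat) (n : 'I_d -> nat)
    (M : forall mu, 'M[R]_(n mu)) (A : tensor R n) : tensor R n := ttm M A.

Lemma nu_isometry (R : realType) (d : nat) (n : 'I_d -> nat)
    (M : forall mu, 'M[R]_(n mu)) (A B : tensor R n) :
  tdot (nu M A) (nu M B) = tdotM M A B.
Proof. by []. Qed.

Definition sym_posdef (R : realType) (n : nat) (A : 'M[R]_n) : Prop :=
  A^T = A /\ forall x : 'cV[R]_n, x != 0 -> 0 < (x^T *m A *m x) 0 0.

Definition other_modes (d : nat) (mu : 'I_d) : seq 'I_d :=
  [seq a <- enum 'I_d | a != mu].

(* The product of the n a for a in s, by recursion so that kron typechecks    *)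
(* without casts.                                                             *)
Fixpoint kron_dim (d : nat) (n : 'I_d -> nat) (s : seq 'I_d) : nat :=
  if s is a :: s' then (kron_dim n s' * n a)%N else 1%N.

Lemma kron_dimE (d : nat) (n : 'I_d -> nat) (mu : 'I_d) :
  kron_dim n (other_modes mu) = (\prod_(a < d | a != mu) n a)%N.
Proof.
rewrite -[RHS]big_filter -/(index_enum _) [index_enum _]unlock.
rewrite -enumT -/(other_modes mu).
elim: other_modes => [|a s IHs] /=; first by rewrite big_nil.
by rewrite big_cons IHs mulnC.
Qed.

(* For s = [:: a_1; ..; a_k] this is A_(a_k) *t .. *t A_(a_1) (reversed       *)
(* order); the empty product is the 1 x 1 identity.                           *)
Fixpoint kron (R : realType) (d : nat) (n p : 'I_d -> nat)
    (A : forall mu, 'M[R]_(n mu, p mu)) (s : seq 'I_d) :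
    'M[R]_(kron_dim n s, kron_dim p s) :=
  if s is a :: s' then kron A s' *t A a else 1%:M.

Definition col_number (d : nat) (n : 'I_d -> nat) (mu : 'I_d)
    (i : multi_index n) : nat :=
  (\sum_(a < d | a != mu) i a * \prod_(b < d | (b < a) && (b != mu)) n b)%N.

(* Exactly one multi-index contributes to each sum; see matricizeE and        *)
(* col_number_lt.                                                             *)
Definition matricize (R : realType) (d : nat) (n : 'I_d -> nat) (mu : 'I_d)
    (A : tensor R n) : 'M[R]_(n mu, kron_dim n (other_modes mu)) :=
  \matrix_(x, y) \sum_(i : multi_index n |
                       (i mu == x) && (col_number mu i == y :> nat)) A i.

Lemma col_number_foldr (d : nat) (n : 'I_d -> nat) (mu : 'I_d)
    (i : multi_index n) :
  col_number mu i =
    foldr (fun a c => c * n a + i a)%N 0%N (other_modes mu).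
Proof.
have Ebig (P : pred 'I_d) (F : 'I_d -> nat) :
  (\sum_(a < d | P a) F a = \sum_(a <- [seq a <- enum 'I_d | P a]) F a)%N.
  by rewrite big_filter big_enum_cond.
have Eprod (a : 'I_d) : (\prod_(b < d | (b < a) && (b != mu)) n b
   = \prod_(b <- other_modes mu | (b < a)) n b)%N.
  by rewrite big_filter_cond big_enum_cond; apply: eq_bigl => b; rewrite andbC.
rewrite /col_number Ebig; under eq_bigr do rewrite Eprod.
rewrite -/(other_modes mu).
have: sorted (fun a b : 'I_d => a < b)%N (other_modes mu).
  apply: sorted_filter; first by move=> ? ? ?; apply: ltn_trans.
  have := iota_ltn_sorted 0 d; rewrite -val_enum_ord.
  by rewrite sorted_map.
elim: (other_modes mu) => [|a s IHs]; first by rewrite big_nil.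
have tr : transitive (fun a b : 'I_d => a < b)%N.
  by move=> ? ? ?; apply: ltn_trans.
move=> /= pas; have /allP lt_a := order_path_min tr pas.
rewrite big_cons big_cons ltnn big_seq_cond big1; last first.
  by move=> b /andP[/lt_a lab]; rewrite ltnNge (ltnW lab).
rewrite muln1 addnC; congr (_ + _)%N.
rewrite -(IHs (path_sorted pas)) big_distrl /=.
rewrite big_seq [RHS]big_seq; apply: eq_bigr => c /lt_a lac.
by rewrite big_cons lac mulnCA mulnC.
Qed.

Lemma col_number_lt (d : nat) (n : 'I_d -> nat) (mu : 'I_d)
    (i : multi_index n) : (col_number mu i < kron_dim n (other_modes mu))%N.
Proof.
rewrite col_number_foldr; elim: other_modes => [//|a s IHs] /=.
exact: (mxtens_index_proof (Ordinal IHs, i a)).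
Qed.

Lemma col_number_inj (d : nat) (n : 'I_d -> nat) (mu : 'I_d)
    (i j : multi_index n) :
  i mu = j mu -> col_number mu i = col_number mu j -> i = j.
Proof.
move=> eq_mu; rewrite !col_number_foldr => eq_col.
have /allP eq_s : all (fun a => i a == j a) (other_modes mu).
  elim: other_modes eq_col => [//|a s IHs] /= eq_col.
  have n_gt0 : (0 < n a)%N by case: (n a) (i a) => // -[].
  have eq_a : i a = j a :> nat.
    move/(congr1 (modn^~ (n a))): eq_col.
    by rewrite !modnMDl !modn_small ?ltn_ord.
  move: eq_col; rewrite eq_a => /addIn/eqP.
  rewrite eqn_pmul2r // => /eqP/IHs ->; rewrite andbT.
  by apply/eqP/val_inj.
apply/ffunP => a; have [->//|ne] := eqVneq a mu.
by apply/eqP/eq_s; rewrite mem_filter ne mem_enum.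
Qed.

Lemma matricizeE (R : realType) (d : nat) (n : 'I_d -> nat) (mu : 'I_d)
    (A : tensor R n) (i : multi_index n) :
  matricize mu A (i mu) (Ordinal (col_number_lt mu i)) = A i.
Proof.
rewrite mxE (big_pred1 i) // => j /=; apply/andP/eqP => [[/eqP e /eqP]|->//].
exact: col_number_inj.
Qed.

(* Reduced singular value decomposition A = P diag(s) Q^T, with all minn m n  *)
(* singular values in nonincreasing order.                                    *)
Definition is_svd (R : realType) (m n : nat) (A : 'M[R]_(m, n))
    (P : 'M[R]_(m, minn m n)) (s : 'rV[R]_(minn m n))
    (Q : 'M[R]_(n, minn m n)) : Prop :=
  [/\ P^T *m P = 1%:M, Q^T *m Q = 1%:M, A = P *m diag_mx s *m Q^T,
      forall k, 0 <= s 0 k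
    & forall k l : 'I_(minn m n), (k <= l)%N -> s 0 l <= s 0 k].

(* The columns of U are orthonormal left singular vectors of A for its r      *)
(* largest singular values, which are the entries of sigma.                   *)
Definition leading_left_singular (R : realType) (m n r : nat)
    (A : 'M[R]_(m, n)) (U : 'M[R]_(m, r)) (sigma : 'rV[R]_r) : Prop :=
  exists (le_r : (r <= minn m n)%N) P s Q,
    [/\ is_svd A P s Q, U = colsub (widen_ord le_r) P
      & sigma = colsub (widen_ord le_r) s].

Definition is_hosvd (R : realType) (d : nat) (n r : 'I_d -> nat)
    (X : tensor R n) (U : forall mu, 'M[R]_(n mu, r mu))
    (sigma : forall mu, 'rV[R]_(r mu)) (C : tensor R r) : Prop :=
  (forall mu, leading_left_singular (matricize mu X) (U mu) (sigma mu)) /\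
  C = ttm (fun mu => (U mu)^T) X.

(* Main.v *)
Require Import Defs.
From mathcomp Require Import all_boot all_order all_algebra.
From mathcomp Require Import mxtens reals.

Set Implicit Arguments.
Unset Strict Implicit.
Unset Printing Implicit Defensive.

Import Order.TTheory GRing.Theory Num.Theory.
Local Open Scope ring_scope.

(** Write X^(mu) for the matricization of X in mode mu, and let K be the Kronecker
    product over the other modes.  Matricization turns the tensor-times-matrix
    product into
      ((A_1, .., A_d) T)^(mu) = A_mu T^(mu) K(A)^T     (matricize_ttm),
    and K is multiplicative, commutes with transposition and preserves
    identities (kron_mulmx, trmx_kron, kron1).  The rest is matrix algebra.

    Since M_a^2 W_a = M_a U_a Sigma_a, the middle factor of the formula is
    K(M) K(U) K(Sigma).  Its outer factors are absorbed by the neighbours: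
    F^(mu) K(M) = M_mu^-1 X^(mu) because X = (M_1, .., M_d) F with M_a symmetric,
    and K(Sigma) (B^(mu))^T = (C^(mu))^T Sigma_mu^-1 by definition of B.  Hence the
    right-hand side is
      M_mu^-1 X^(mu) K(U) (C^(mu))^T Sigma_mu^-1
        = M_mu^-1 X^(mu) K(U) K(U)^T (X^(mu))^T U_mu Sigma_mu^-1.
    The hypothesis X = (U_1, .., U_d) C puts the rows of X^(mu) in the column space
    of K(U), whose columns are orthonormal, so K(U) K(U)^T disappears.  What
    remains is X^(mu) (X^(mu))^T U_mu = U_mu Sigma_mu^2, the eigenvector property of
    left singular vectors (leading_left_singularP), and one factor Sigma_mu
    cancels, leaving M_mu^-1 U_mu Sigma_mu = W_mu.

    The bound on the multilinear rank is what makes each Sigma_a invertible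
    (leading_singular_values_unit). *)

(** * Kronecker products over a list of modes *)

Lemma tensmx1 (R : comPzRingType) (m n : nat) :
  (1%:M : 'M[R]_m) *t (1%:M : 'M[R]_n) = 1%:M.
Proof.
apply/matrixP => x y; case: (mxtens_indexP x) => i j.
case: (mxtens_indexP y) => k l.
rewrite tensmxE !mxE (can_eq (@mxtens_indexK _ _)) xpair_eqE.
by case: eqP; case: eqP; rewrite ?mul1r ?mul0r.
Qed.

Lemma eq_kron (R : realType) (d : nat) (n p : 'I_d -> nat)
    (A B : forall a, 'M[R]_(n a, p a)) (s : seq 'I_d) :
  (forall a, A a = B a) -> kron A s = kron B s.
Proof. by move=> eqAB; elim: s => //= a s ->; rewrite eqAB. Qed.

Lemma kron_mulmx (R : realType) (d : nat) (n p q : 'I_d -> nat)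
    (A : forall a, 'M[R]_(n a, p a)) (B : forall a, 'M[R]_(p a, q a))
    (s : seq 'I_d) :
  kron (fun a => A a *m B a) s = kron A s *m kron B s.
Proof. by elim: s => [|a s IHs] /=; rewrite ?mulmx1 // IHs tensmx_mul. Qed.

Lemma trmx_kron (R : realType) (d : nat) (n p : 'I_d -> nat)
    (A : forall a, 'M[R]_(n a, p a)) (s : seq 'I_d) :
  (kron A s)^T = kron (fun a => (A a)^T) s.
Proof. by elim: s => [|a s IHs] /=; rewrite ?trmx1 // trmx_tens IHs. Qed.

Lemma kron1 (R : realType) (d : nat) (n : 'I_d -> nat) (s : seq 'I_d) :
  kron (fun a => 1%:M : 'M[R]_(n a)) s = 1%:M.
Proof. by elim: s => [|a s IHs] //=; rewrite IHs tensmx1. Qed.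

(** * Matricization of a tensor-times-matrix product *)

(** The column of [kron] addressed by a multi-index.  It has the value of
    [col_number], but as an ordinal built by the recursion that defines [kron],
    so that entries of [kron] reduce to entries of [*t]. *)
Fixpoint kron_index (d : nat) (n : 'I_d -> nat) (s : seq 'I_d)
    (i : multi_index n) : 'I_(kron_dim n s) :=
  if s is a :: s' then mxtens_index (kron_index s' i, i a) else ord0.

Lemma kronE (R : realType) (d : nat) (n p : 'I_d -> nat)
    (A : forall a, 'M[R]_(n a, p a)) (s : seq 'I_d)
    (i : multi_index n) (j : multi_index p) :
  kron A s (kron_index s i) (kron_index s j) = \prod_(a <- s) A a (i a) (j a).
Proof.
elim: s => [|a s IHs] /=; first by rewrite big_nil mxE.
by rewrite big_cons tensmxE IHs mulrC.
Qed.

Lemma kron_index_col_number (d : nat) (n : 'I_d -> nat) (mu : 'I_d)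
    (i : multi_index n) :
  kron_index (other_modes mu) i = col_number mu i :> nat.
Proof. by rewrite col_number_foldr; elim: other_modes => //= a s ->. Qed.

Lemma matricize_kron_index (R : realType) (d : nat) (n : 'I_d -> nat)
    (mu : 'I_d) (A : tensor R n) (i : multi_index n) :
  matricize mu A (i mu) (kron_index (other_modes mu) i) = A i.
Proof.
rewrite -(matricizeE mu); congr (matricize _ _ _ _).
exact/val_inj/kron_index_col_number.
Qed.

(** The numbering of the columns is injective, and the numbers of multi-indices
    and of matrix positions agree, so every position comes from a unique
    multi-index. *)
Lemma matricize_position_bij (d : nat) (n : 'I_d -> nat) (mu : 'I_d) :
  bijective (fun i : multi_index n => (i mu, kron_index (other_modes mu) i)).
Proof.
apply: inj_card_bij => [i j [eq_mu /(congr1 val)]|].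
  by rewrite /= !kron_index_col_number; apply: col_number_inj.
rewrite card_prod !card_ord kron_dimE card_dep_ffun foldrE big_map.
rewrite big_enum /= [leqRHS](bigD1 mu) //= card_ord leq_mul2l.
by rewrite orbC; under [leqRHS]eq_bigr do rewrite card_ord; rewrite leqnn.
Qed.

(** A sum over multi-indices factors into a sum over mode [mu] and a sum over
    the columns, and the coefficient of the product factors accordingly. *)
Lemma matricize_ttm (R : realType) (d : nat) (n p : 'I_d -> nat) (mu : 'I_d)
    (A : forall a, 'M[R]_(p a, n a)) (T : tensor R n) :
  matricize mu (ttm A T) =
    A mu *m matricize mu T *m (kron A (other_modes mu))^T.
Proof.
apply/matrixP => x y.
have [g _ gK] := matricize_position_bij p mu.
move: (g (x, y)) (gK (x, y)) => i [eq_x eq_y].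
rewrite -eq_x -eq_y {eq_x eq_y}.
rewrite matricize_kron_index ffunE -mulmxA mxE.
under [RHS]eq_bigr do rewrite mxE big_distrr.
rewrite pair_big /= (reindex _ (onW_bij _ (matricize_position_bij n mu))) /=.
apply: eq_bigr => j _.
rewrite matricize_kron_index mxE kronE (bigD1 mu) //= big_filter big_enum_cond.
by rewrite mulrAC mulrA.
Qed.

(** * Leading singular vectors *)

(** If [J] selects the leading columns, then [U = P J] and
    [diag s J = J diag sigma]; orthonormality of the columns of [P] and [Q]
    reduces [A A^T U] to [P (diag s)^2 J], through which [J] moves left. *)
Lemma leading_left_singularP (R : realType) (m n r : nat) (A : 'M[R]_(m, n))
    (U : 'M[R]_(m, r)) (sigma : 'rV[R]_r) :
  leading_left_singular A U sigma ->
  U^T *m U = 1%:M /\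
  A *m A^T *m U = U *m diag_mx sigma *m diag_mx sigma.
Proof.
case=> le_r [P [s [Q [[PP QQ -> _ _] -> ->]]]].
set f := widen_ord le_r; pose J : 'M[R]_(_, r) := colsub f 1%:M.
have inj_f : injective f by move=> k l /(congr1 val)/= /val_inj.
have JJ : J^T *m J = 1%:M.
  rewrite /J trmx_mxsub trmx1 -mxsub_mul mulmx1.
  by apply/matrixP => k l; rewrite !mxE (inj_eq inj_f).
have sJ : diag_mx s *m J = J *m diag_mx (colsub f s).
  apply/matrixP => k l; rewrite mul_diag_mx mul_mx_diag !mxE.
  by case: eqP => [->|]; rewrite ?mul1r ?mulr1 ?mul0r ?mulr0.
have -> : colsub f P = P *m J by rewrite mulmx_colsub mulmx1.
split; first by rewrite trmx_mul mulmxA -(mulmxA J^T) PP mulmx1.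
rewrite !trmx_mul trmxK tr_diag_mx -!mulmxA (mulmxA P^T) PP mul1mx.
by rewrite (mulmxA Q^T) QQ mul1mx sJ (mulmxA _ J) sJ !mulmxA.
Qed.

(** A vanishing singular value annihilates all later ones, which bounds the rank
    by its position. *)
Lemma leading_singular_values_unit (R : realType) (m n r : nat)
    (A : 'M[R]_(m, n)) (U : 'M[R]_(m, r)) (sigma : 'rV[R]_r) :
  leading_left_singular A U sigma -> (r <= \rank A)%N ->
  diag_mx sigma \in unitmx.
Proof.
case=> le_r [P [s [Q [[_ _ -> s_ge0 s_mono] _ ->]]]] le_rank.
rewrite unitmxE det_diag unitfE; apply/prodf_neq0 => k _; rewrite mxE.
apply/eqP => sk0; move: le_rank; apply/negP; rewrite -ltnNge.
apply: leq_ltn_trans (ltn_ord k).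
have le_k : (k <= minn m n)%N by exact: ltnW (leq_trans (ltn_ord k) le_r).
(* The entries of [s] from [k] on are nonnegative and at most [s 0 k = 0]. *)
have -> : diag_mx s = diag_mx s *m pid_mx k.
  apply/matrixP => i j; rewrite mul_diag_mx !mxE.
  have [<-|] := eqVneq i j; last first.
    by rewrite -val_eqE => /negbTE ->; rewrite mulr0.
  rewrite eqxx /= mulr1n; case: ltnP => [|le_ki]; rewrite ?mulr1 ?mulr0 //=.
  by apply/eqP; rewrite eq_le s_ge0 -[leRHS]sk0 s_mono.
rewrite -[leqRHS](rank_pid_mx R le_k le_k).
apply: leq_trans (mxrankM_maxl _ _) _.
by rewrite mulmxA mxrankM_maxr.
Qed.

(** A nonzero row of the kernel would be a vector on which the quadratic form
    vanishes. *)
Lemma sym_posdef_unit (R : realType) (n : nat) (A : 'M[R]_n) :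
  sym_posdef A -> A \in unitmx.
Proof.
case=> _ posA; rewrite -row_free_unit -kermx_eq0.
apply/eqP/row_matrixP => i; rewrite row0; apply/eqP/negPn/negP => v_neq0.
have := posA (row i (kermx A))^T; rewrite trmx_eq0 => /(_ v_neq0).
by rewrite trmxK -row_mul mulmx_ker row0 mul0mx mxE ltxx.
Qed.

(** * The principal components *)

Theorem proposition4 (R : realType) (d : nat) (n r : 'I_d -> nat)
    (M : forall mu, 'M[R]_(n mu)) (F X : tensor R n)
    (U : forall mu, 'M[R]_(n mu, r mu)) (sigma : forall mu, 'rV[R]_(r mu))
    (C : tensor R r) :
  (2 <= d)%N ->
  (forall mu, sym_posdef (M mu)) ->
  X = nu M F ->
  is_hosvd X U sigma C ->
  (forall mu, (r mu <= \rank (matricize mu X))%N) ->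
  X = ttm U C ->
  let Sigma mu := diag_mx (sigma mu) in
  let Y mu := U mu *m Sigma mu in
  let W mu := invmx (M mu) *m Y mu in
  let B := ttm (fun mu => invmx (Sigma mu)) C in
  forall mu : 'I_d,
    W mu = matricize mu F
           *m kron (fun a => M a ^+ 2 *m W a) (other_modes mu)
           *m (matricize mu B)^T.
Proof.
move=> _ Mpd XF [hU CX] le_r XC Sigma Y W B mu.
set s := other_modes mu.
have Mu a : M a \in unitmx := sym_posdef_unit (Mpd a).
have Su a : Sigma a \in unitmx := leading_singular_values_unit (hU a) (le_r a).
have UU a : (U a)^T *m U a = 1%:M by case: (leading_left_singularP (hU a)).
have [_ XXU] := leading_left_singularP (hU mu).
have KW : kron (fun a => M a ^+ 2 *m W a) s
          = kron M s *m kron U s *m kron Sigma s.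
  rewrite -!kron_mulmx; apply: eq_kron => a.
  (* [n a] is not a successor, so the square is unfolded to [*m] by conversion. *)
  by rewrite -[M a ^+ 2]/(M a *m M a) /W -mulmxA mulKVmx // /Y !mulmxA.
have FM : matricize mu F *m kron M s = invmx (M mu) *m matricize mu X.
  rewrite XF matricize_ttm -mulmxA mulKmx // trmx_kron.
  by congr (_ *m _); apply: eq_kron => a; case: (Mpd a).
have SB : kron Sigma s *m (matricize mu B)^T
          = (matricize mu C)^T *m invmx (Sigma mu).
  rewrite matricize_ttm !trmx_mul trmxK trmx_inv tr_diag_mx !mulmxA.
  rewrite -kron_mulmx (eq_kron _ (B := fun=> 1%:M)) ?kron1 ?mul1mx // => a.
  exact: mulmxV.
have XUU : matricize mu X *m kron U s *m (kron U s)^T = matricize mu X.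
  have KUU : (kron U s)^T *m kron U s = 1%:M.
    by rewrite trmx_kron -kron_mulmx (eq_kron _ (B := fun=> 1%:M)) ?kron1.
  by rewrite XC matricize_ttm -!mulmxA (mulmxA (kron U s)^T) KUU mul1mx.
have CT : (matricize mu C)^T = (kron U s)^T *m (matricize mu X)^T *m U mu.
  by rewrite CX matricize_ttm !trmx_mul !trmxK -trmx_kron mulmxA.
rewrite KW !mulmxA FM -(mulmxA _ (kron Sigma s)) SB CT !mulmxA.
rewrite -(mulmxA _ (matricize mu X)) -(mulmxA _ _ (kron U s)^T) XUU.
rewrite -!(mulmxA (invmx (M mu))) XXU -/Sigma.
by rewrite /W /Y mulmxK.
Qed.
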